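(* Let $I$ be a compact interval with interior $J$. Suppose $f,g,h\in\mathrm{Diffeo}(I)$, $f$ is fixed-point-free on $J$, and $f=h^{-1}\circ g\circ h$. Then $H(x,h(x))$ is constant for $x\in J$. Thus, given any $a,\alpha\in J$, there is some $\kappa>0$ such that $$F_a(x)=\kappa\, G_\alpha(h(x)),\qquad \forall x\in J.$$
   Context: $\mathrm{Diffeo}(I)$ is the group of infinitely differentiable diffeomorphisms of $I$ (one-sided derivatives at endpoints). $f^{\circ n}$ ($n\in\mathbb Z$) is the $n$-th iterate of $f$. For $x,\xi,a,\alpha\in J$, $$H(x,\xi)=\prod_{n=-\infty}^{\infty}\frac{f'(f^{\circ n}(x))}{g'(g^{\circ n}(\xi))},\quad F_a(x)=\prod_{n=-\infty}^{\infty}\frac{f'(f^{\circ n}(x))}{f'(f^{\circ n}(a))},\quad G_\alpha(\xi)=\prod_{n=-\infty}^{\infty}\frac{g'(g^{\circ n}(\xi))}{g'(g^{\circ n}(\alpha))}.$$ A two-sided infinite product is understood to converge when both one-sided products converge to nonzero limits. *)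

(* Defs.v *)
From HB Require Import structures.
From mathcomp Require Import all_boot all_order all_algebra.
From mathcomp Require Import all_classical all_reals all_analysis.
Set Implicit Arguments.
Unset Strict Implicit.
Unset Printing Implicit Defensive.
Import Order.TTheory GRing.Theory Num.Theory.
Import numFieldNormedType.Exports.
Local Open Scope classical_set_scope.
Local Open Scope ring_scope.

(* Maps of an interval A are represented by functions R -> R of which only the
   values on A matter.  Accordingly, derivatives are taken along A: on the
   interior of A this is the usual derivative, and at an endpoint of A it is
   the one-sided derivative. *)
Definition diff_quot (R : realType) (f : R -> R) (x : R) : R -> R :=
  fun y => (f y - f x) / (y - x).

Definition derivable_on (R : realType) (A : set R) (f : R -> R) (x : R) : Prop :=
  cvg (diff_quot f x @ within A x^').

Definition derive_on (R : realType) (A : set R) (f : R -> R) : R -> R :=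
  fun x => lim (diff_quot f x @ within A x^').

Definition smooth_on (R : realType) (A : set R) (f : R -> R) : Prop :=
  forall (n : nat) (x : R), A x -> derivable_on A (iter n (derive_on A) f) x.

(* pinv A f is the inverse of the restriction of f to A. *)
Definition diffeo (R : realType) (A : set R) (f : R -> R) : Prop :=
  [/\ set_bij A A f, smooth_on A f & smooth_on A (pinv A f)].

Definition iterz (R : realType) (A : set R) (f : R -> R) (n : int) : R -> R :=
  match n with
  | Posz k => iter k f
  | Negz k => iter k.+1 (pinv A f)
  end.

(* The one-sided partial products of u : int -> R are u_0 ... u_(N-1) and
   u_(-1) ... u_(-N). *)
Definition prod_right (R : realType) (u : int -> R) : R^nat :=
  fun N => \prod_(0 <= k < N) u k%:Z.

Definition prod_left (R : realType) (u : int -> R) : R^nat :=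
  fun N => \prod_(0 <= k < N) u (- k.+1%:Z).

Definition biprod_cvg (R : realType) (u : int -> R) : Prop :=
  [/\ cvgn (prod_right u), limn (prod_right u) != 0,
      cvgn (prod_left u) & limn (prod_left u) != 0].

(* Meaningful only under biprod_cvg u. *)
Definition biprod (R : realType) (u : int -> R) : R :=
  limn (prod_left u) * limn (prod_right u).

Definition H_factor (R : realType) (A : set R) (f g : R -> R) (x xi : R)
    (n : int) : R :=
  derive_on A f (iterz A f n x) / derive_on A g (iterz A g n xi).

Definition H_prod (R : realType) (A : set R) (f g : R -> R) (x xi : R) : R :=
  biprod (H_factor A f g x xi).

(* F_a is F_prod A f a, and G_alpha is F_prod A g alpha. *)
Definition F_factor (R : realType) (A : set R) (f : R -> R) (a x : R)
    (n : int) : R :=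
  derive_on A f (iterz A f n x) / derive_on A f (iterz A f n a).

Definition F_prod (R : realType) (A : set R) (f : R -> R) (a x : R) : R :=
  biprod (F_factor A f a x).

(* Main.v *)
Require Import Defs.
From HB Require Import structures.
From mathcomp Require Import all_boot all_order all_algebra.
From mathcomp Require Import all_classical all_reals all_analysis.
From mathcomp Require Import lra.
Import Order.TTheory GRing.Theory Num.Theory.
Import numFieldNormedType.Exports.
Set Implicit Arguments.
Unset Strict Implicit.
Local Open Scope classical_set_scope.
Local Open Scope ring_scope.

(** Differentiating h o f = g o h gives

      f'(y) / g'(h y) = h'(y) / h'(f y)      for y in I,

    so along the orbit x_n of x under f the n-th factor of H(x, h x) is
    h'(x_n) / h'(x_{n+1}) and both one-sided products telescope
    ([prod_right_H], [prod_left_H]) to h'(x) / h'(x_N) and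
    h'(x_{-N}) / h'(x).  As f has no fixed point in J, every forward orbit tends
    to one endpoint r of I and every backward orbit to one endpoint l, neither
    depending on x ([cvg_iter_end]); since h' is continuous and does not vanish
    on I, the products converge and H(x, h x) = h'(l) / h'(r)
    ([H_prod_constant]).

    The products F_a and G_alpha have to be shown convergent on their own
    ([F_factor_biprod_cvg]).  Here f' is positive and Lipschitz on I, hence so is
    ln f', and it is enough to bound the sum of the |x_n - a_n|.  Say that f moves
    points to the right and a <= x.  Then x <= a_k for some k, so that
    a_n <= x_n <= a_{n+k} and the sum is at most the sum of the
    a_{n+k} - a_n, which telescopes to at most k (q - p)
    ([displacement_bounded_up]).  The case of points moved to the left follows by
    reflecting the interval, and the backward product by passing to the inverse of
    f, which is again a diffeomorphism without fixed point in J.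

    Finally, factor by factor,

      H(x, h x) G_alpha(h x) = H(a, h a) F_a(x) G_alpha(h a),

    and the two values of H are the same nonzero constant, so that
    kappa = 1 / G_alpha(h a) works; it is positive because g' is. *)

(** * Derivatives along a set *)

Lemma derivable_on_cvg (R : realType) (A : set R) (f : R -> R) (x : R) :
  derivable_on A f x -> diff_quot f x @ within A x^' --> derive_on A f x.
Proof. by []. Qed.

Lemma cvg_derive_on (R : realType) (A : set R) (f : R -> R) (x l : R) :
  ProperFilter (within A x^') ->
  diff_quot f x @ within A x^' --> l -> derive_on A f x = l.
Proof. by move=> PF fl; apply: cvg_lim. Qed.

(** The next two equivalences hold by conversion; as views they keep the unfolded
    form of the filters readable. *)
Lemma near_within_dnbhs (R : realType) (A : set R) (x : R) (P : set R) :
  (\forall y \near within A x^', P y) <->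
  (\forall y \near x, y != x -> A y -> P y).
Proof. by []. Qed.

Lemma near_within_nbhs (R : realType) (A : set R) (x : R) (P : set R) :
  (\forall y \near within A (nbhs x), P y) <->
  (\forall y \near x, A y -> P y).
Proof. by []. Qed.

Lemma diff_quot_eq_in (R : realType) (A : set R) (f1 f2 : R -> R) (x : R) :
  A x -> (forall y, A y -> f1 y = f2 y) ->
  diff_quot f1 x @ within A x^' = diff_quot f2 x @ within A x^'.
Proof.
move=> Ax ef.
have sub g1 g2 : (forall y, A y -> g1 y = g2 y) ->
    diff_quot g1 x @ within A x^' `<=` diff_quot g2 x @ within A x^'.
  move=> eg P /near_within_dnbhs HP; apply/near_within_dnbhs.
  by apply: filterS HP => y H yx Ay; have := H yx Ay; rewrite /= /diff_quot !eg.
by rewrite eqEsubset; split; apply: sub => // y /ef.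
Qed.

Lemma eq_in_derive_on (R : realType) (A : set R) (f1 f2 : R -> R) (x : R) :
  A x -> (forall y, A y -> f1 y = f2 y) -> derive_on A f1 x = derive_on A f2 x.
Proof. by move=> Ax ef; rewrite /derive_on (diff_quot_eq_in Ax ef). Qed.

Lemma eq_in_smooth_on (R : realType) (A : set R) (f1 f2 : R -> R) :
  (forall y, A y -> f1 y = f2 y) -> smooth_on A f1 -> smooth_on A f2.
Proof.
move=> ef sf n x Ax.
have eit : forall k y, A y -> iter k (derive_on A) f1 y = iter k (derive_on A) f2 y.
  by elim=> [|k IH] y Ay /=; [exact: ef|exact: eq_in_derive_on].
by rewrite /derivable_on -(diff_quot_eq_in Ax (eit n)); exact: sf.
Qed.

Lemma derivable_on_continuous (R : realType) (A : set R) (f : R -> R) (x : R) :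
  derivable_on A f x -> f @ within A (nbhs x) --> f x.
Proof.
move=> /derivable_on_cvg df.
have idx : id @ within A x^' --> x.
  by move=> P Px; apply/near_within_dnbhs; apply: (@filterS _ (nbhs x) _ P) => // y Py _ _.
(* This function agrees with f away from x. *)
have fx : (fun y => diff_quot f x y * (y - x) + f x) @ within A x^' --> f x.
  rewrite -[X in _ --> X]add0r -(mulr0 (derive_on A f x)) -(subrr x).
  exact: cvgD (cvgM df (cvgB idx (cvg_cst x))) (cvg_cst (f x)).
move=> P Px; have /near_within_dnbhs HP := fx P Px; apply/near_within_nbhs.
apply: filterS HP => y H Ay.
have [->|yx] := eqVneq y x; first exact: (nbhs_singleton Px).
by have := H yx Ay; rewrite /= /diff_quot mulfVK ?subrK // subr_eq0.
Qed.

(** Injectivity of f makes the usual case f y = f x of the chain rule void: the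
    difference quotient of g o f is then literally the product of those of g and
    f. *)
Lemma derive_on_comp (R : realType) (A B : set R) (f g : R -> R) (x : R) :
  ProperFilter (within A x^') -> A x ->
  (forall y, A y -> B (f y)) -> {in A &, injective f} ->
  derivable_on A f x -> derivable_on B g (f x) ->
  derive_on A (g \o f) x = derive_on B g (f x) * derive_on A f x.
Proof.
move=> PF Ax AB fi df dg; apply: cvg_derive_on.
have fyx y : A y -> y != x -> f y != f x.
  by move=> Ay; apply: contra_neq => fyx; apply: fi; rewrite ?inE.
have fd : f @ within A x^' --> within B (f x)^'.
  move=> P /near_within_dnbhs HP; apply/near_within_dnbhs.
  have /near_within_nbhs := derivable_on_continuous df HP.
  by apply: filterS => y H yx Ay; apply: (H Ay (fyx _ Ay yx) (AB _ Ay)).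
have gd := cvg_comp _ _ fd (derivable_on_cvg dg).
move=> P /(cvgM gd (derivable_on_cvg df))/near_within_dnbhs HP.
apply/near_within_dnbhs; apply: filterS HP => y H yx Ay.
have := H yx Ay.
by rewrite /= /diff_quot /= mulrA mulfVK // subr_eq0 fyx.
Qed.

Lemma derive_on_id (R : realType) (A : set R) (x : R) :
  ProperFilter (within A x^') -> derive_on A id x = 1.
Proof.
move=> PF; apply: cvg_derive_on => P P1; apply/near_within_dnbhs.
apply: (@filterE _ (nbhs x)) => y yx _.
by rewrite /= /diff_quot mulfV ?subr_eq0 //; exact: (nbhs_singleton P1).
Qed.

(** Limits along I are unique at every point of I, endpoints included. *)
Lemma proper_within_itv (R : realType) (p q x : R) : p < q -> p <= x <= q ->
  ProperFilter (within `[p, q]%classic x^').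
Proof.
move=> pq /andP[px xq]; apply: Build_ProperFilter_ex.
move=> P /= []; rewrite /ball_ /= => e /= e0 H.
have [xltq|qlex] := ltP x q.
  pose y := x + Num.min (e / 2) (q - x).
  have m0 : 0 < Num.min (e / 2) (q - x) by rewrite lt_min; apply/andP; split; lra.
  have m1 : Num.min (e / 2) (q - x) <= e / 2 by rewrite ge_min lexx.
  have m2 : Num.min (e / 2) (q - x) <= q - x by rewrite ge_min lexx orbT.
  exists y; apply: H => /=; rewrite /y.
  - by rewrite opprD addrA subrr add0r normrN gtr0_norm //; lra.
  - by apply/eqP; lra.
  - by rewrite in_itv /=; apply/andP; split; lra.
pose y := x - Num.min (e / 2) (x - p).
have m0 : 0 < Num.min (e / 2) (x - p) by rewrite lt_min; apply/andP; split; lra.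
have m1 : Num.min (e / 2) (x - p) <= e / 2 by rewrite ge_min lexx.
have m2 : Num.min (e / 2) (x - p) <= x - p by rewrite ge_min lexx orbT.
exists y; apply: H => /=; rewrite /y.
- by rewrite opprB addrC subrK gtr0_norm //; lra.
- by apply/eqP; lra.
- by rewrite in_itv /=; apply/andP; split; lra.
Qed.

Lemma derive_on_interior (R : realType) (p q : R) (F : R -> R) (x : R) :
  p < x < q -> derivable_on `[p, q]%classic F x ->
  is_derive x 1 F (derive_on `[p, q]%classic F x).
Proof.
move=> pxq dF.
suff H : (fun h => h^-1 *: ((F \o shift x) (h *: 1) - F x)) @ 0^' -->
    derive_on `[p, q]%classic F x.
  split; first by apply/cvg_ex; eexists; exact: H.
  exact: cvg_lim H.
move=> P /(derivable_on_cvg dF)/near_within_dnbhs HP.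
have Ix : \forall y \near x, y \in `]p, q[ by apply: near_in_itvoo; rewrite in_itv.
pose Q y := (y != x -> `[p, q]%classic y -> P (diff_quot F x y)) /\ y \in `]p, q[.
have HQ : \forall y \near x, Q y by exact: filterI HP Ix.
have : \forall h \near 0, Q (x + h) by exact: (nbhs0P Q x).1 HQ.
apply: filterS => h [H Ih] h0.
have := H _ _; rewrite /diff_quot /= [h *: 1]mulr1 -[h^-1 *: _]/(h^-1 * _).
rewrite (addrC x h) addrK mulrC; apply.
  by rewrite -subr_eq0 addrK.
by move: Ih; rewrite addrC /= !in_itv /= => /andP[/ltW -> /ltW ->].
Qed.

Lemma within_continuous_derivable_on (R : realType) (A : set R) (F : R -> R) :
  (forall x, A x -> derivable_on A F x) -> {within A, continuous F}.
Proof.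
by move=> dF; apply/subspace_continuousP => x /dF; exact: derivable_on_continuous.
Qed.

(** By the mean value theorem, the maximum of |F'| on the compact interval is a
    Lipschitz constant. *)
Lemma lipschitz_derive_on (R : realType) (p q : R) (F : R -> R)
    (I := `[p, q]%classic) : p < q ->
  (forall x, I x -> derivable_on I F x) -> {within I, continuous (derive_on I F)} ->
  exists2 C, 0 <= C & forall x y, I x -> I y -> `|F x - F y| <= C * `|x - y|.
Proof.
move=> pq dF cF'.
have cF : {within I, continuous F} by exact: within_continuous_derivable_on.
have cn : {within I, continuous (fun x => `|derive_on I F x|)}.
  by move=> x; apply: cvg_norm; exact: cF'.
have [c _ cmax] := EVT_max (ltW pq) cn.
exists `|derive_on I F c| => //.
suff H x y : I x -> I y -> x <= y -> `|F y - F x| <= `|derive_on I F c| * `|y - x|.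
  move=> x y Ix Iy; have [xy|/ltW xy] := leP x y.
    by rewrite distrC (distrC x); exact: H.
  exact: H.
rewrite /I /= !in_itv /= => /andP[px xq] /andP[py yq] xy.
have [z zxy ->] : exists2 z, z \in `[x, y] & F y - F x = derive_on I F z * (y - x).
  apply: MVT_segment xy _ _.
    move=> z; rewrite in_itv /= => /andP[xz zy]; apply: derive_on_interior.
      by rewrite (le_lt_trans px) ?(lt_le_trans zy).
    by apply: dF; rewrite /I /= in_itv /= ?(ltW (le_lt_trans px _)) ?(ltW (lt_le_trans zy _)).
  apply: continuous_subspaceW cF => z; rewrite /I /= !in_itv /= => /andP[xz zy].
  by rewrite (le_trans px) ?(le_trans zy).
rewrite normrM ler_wpM2r // cmax //.
move: zxy; rewrite !in_itv /= => /andP[xz zy].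
by rewrite (le_trans px) ?(le_trans zy).
Qed.

(** * Diffeomorphisms of a set *)

Section Diffeo_set.
Variables (R : realType) (A : set R) (f : R -> R).
Hypothesis fD : diffeo A f.

Lemma diffeo_fun x : A x -> A (f x).
Proof. by case: fD => -[+ _ _] _ _ => /[apply]. Qed.

Lemma diffeo_inj : {in A &, injective f}.
Proof. by case: fD => -[]. Qed.

Lemma diffeo_pinvK y : A y -> f (pinv A f y) = y.
Proof. by case: fD => -[_ _ fs] _ _ Ay; apply: surjpK fs _ _; rewrite inE. Qed.

Lemma diffeoK x : A x -> pinv A f (f x) = x.
Proof. by move=> Ax; apply: pinvKV; [exact: diffeo_inj|rewrite inE]. Qed.

(** The inverse of the inverse is f on A only, which suffices because the iterated
    derivatives along A depend on the values on A only. *)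
Lemma diffeo_pinv : diffeo A (pinv A f).
Proof.
case: (fD) => fb sf sp; have pb := bijpinv_bij (fun=> point) fb.
split=> //; apply: eq_in_smooth_on sf => y Ay.
have [pf pi _] := pb.
have Afy := diffeo_fun Ay.
rewrite -[in RHS](diffeoK Ay) pinvKV ?inE //.
Qed.

Lemma diffeo_derivable x : A x -> derivable_on A f x.
Proof. by case: fD => _ /(_ 0%N x). Qed.

Lemma diffeo_continuous : {within A, continuous f}.
Proof. exact: within_continuous_derivable_on diffeo_derivable. Qed.

Lemma diffeo_derive_continuous : {within A, continuous (derive_on A f)}.
Proof.
by case: fD => _ sf _; apply: within_continuous_derivable_on => x; exact: (sf 1%N).
Qed.

End Diffeo_set.

(** * Fixed-point-free increasing maps of an open interval *)

(** Only the open interval enters, so that the same results serve a diffeomorphism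
    of the closed interval and its inverse. *)
Definition free_map (R : realType) (p q : R) (phi : R -> R) : Prop :=
  [/\ forall x, x \in `]p, q[ -> phi x \in `]p, q[,
      {in `]p, q[ &, {homo phi : x y / x <= y}},
      {in `]p, q[, continuous phi} &
      forall x, x \in `]p, q[ -> phi x != x].

Definition displacement_bounded (R : realType) (p q : R) (phi : R -> R) : Prop :=
  forall a x, a \in `]p, q[ -> x \in `]p, q[ ->
    exists M, forall N, \sum_(0 <= k < N) `|iter k phi x - iter k phi a| <= M.

Section Free_map.
Variables (R : realType) (p q : R).
Implicit Type phi : R -> R.

Lemma free_map_iter phi n x :
  free_map p q phi -> x \in `]p, q[ -> iter n phi x \in `]p, q[.
Proof. by case=> pJ _ _ _ xJ; elim: n => //= n; exact: pJ. Qed.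

Lemma iter_le_homo phi n x y : free_map p q phi ->
  x \in `]p, q[ -> y \in `]p, q[ -> x <= y -> iter n phi x <= iter n phi y.
Proof.
move=> F xJ yJ xy; elim: n => //= n IH; have [_ ph _ _] := F.
by apply: ph => //; exact: free_map_iter.
Qed.

(** By the intermediate value theorem phi - id keeps a constant sign. *)
Lemma free_map_sign phi : free_map p q phi ->
  (forall x, x \in `]p, q[ -> x < phi x) \/ (forall x, x \in `]p, q[ -> phi x < x).
Proof.
case=> pJ _ pc pfree.
(* Two points moved in opposite directions enclose a fixed point. *)
have noswitch x y : x \in `]p, q[ -> y \in `]p, q[ ->
    x < phi x -> phi y < y -> False.
  move=> xJ yJ xlt ylt.
  have zero a b : a \in `]p, q[ -> b \in `]p, q[ -> a <= b ->
      Num.min (phi a - a) (phi b - b) <= 0 <= Num.max (phi a - a) (phi b - b) ->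
      False.
    move=> aJ bJ ab ab0.
    have Jsub c : c \in `[a, b] -> c \in `]p, q[.
      move: aJ bJ; rewrite !in_itv /= => /andP[pa _] /andP[_ bq] /andP[ac cb].
      by rewrite (lt_le_trans pa ac) (le_lt_trans cb bq).
    have c0 : {within `[a, b], continuous (fun z => phi z - z)}.
      apply: continuous_subspace_itv => z zab; apply: cvgB; last exact: cvg_id.
      by apply: pc; exact: Jsub.
    have [c cab /eqP] := IVT ab c0 ab0.
    by rewrite subr_eq0; exact/negP/pfree/Jsub.
  have [xy|/ltW yx] := leP x y.
    apply: (zero x y) => //.
    by rewrite ge_min le_max !subr_le0 !subr_ge0 (ltW xlt) (ltW ylt) orbT.
  apply: (zero y x) => //.
  by rewrite ge_min le_max !subr_le0 !subr_ge0 (ltW xlt) (ltW ylt) orbT.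
case: (pselect (exists2 x, x \in `]p, q[ & x < phi x)) => [[x xJ xlt]|no].
  left=> y yJ; rewrite ltNge le_eqVlt (negbTE (pfree y yJ)) /=.
  by apply/negP => ylt; exact: (noswitch x y).
right=> y yJ; rewrite lt_neqAle pfree // leNgt; apply/negP => ylt.
by apply: no; exists y.
Qed.

(** Conjugating by the reflection of the interval exchanges maps moving points to
    the right with maps moving points to the left. *)
Definition flip (x : R) := p + q - x.

Lemma flipK : involutive flip.
Proof. by move=> x; rewrite /flip opprB addrC subrK. Qed.

Lemma flip_itv x : (flip x \in `]p, q[) = (x \in `]p, q[).
Proof. by rewrite /flip !in_itv /=; apply/andP/andP => -[? ?]; split; lra. Qed.

Lemma flip_continuous : continuous flip.
Proof. by move=> x; apply: cvgB; [exact: cvg_cst|exact: cvg_id]. Qed.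

Lemma flip_conj_free_map phi :
  free_map p q phi -> free_map p q (flip \o phi \o flip).
Proof.
case=> pJ ph pc pfree; split=> /=.
- by move=> x xJ; rewrite flip_itv pJ // flip_itv.
- move=> x y xJ yJ xy.
  have : phi (flip y) <= phi (flip x).
    by apply: ph; rewrite ?flip_itv // /flip; lra.
  by rewrite /= /flip; lra.
- move=> x xJ; apply: continuous_comp; first exact: flip_continuous.
  by apply: continuous_comp; [apply: pc; rewrite flip_itv|exact: flip_continuous].
- move=> x xJ; have : phi (flip x) != flip x by apply: pfree; rewrite flip_itv.
  by apply: contra_neq => /= fx; rewrite -[in RHS]fx flipK.
Qed.

Lemma iter_flip_conj phi n x :
  iter n (flip \o phi \o flip) (flip x) = flip (iter n phi x).
Proof. by elim: n => //= n ->; rewrite flipK. Qed.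

(** The orbit increases, and its limit cannot lie inside the interval, where it
    would be a fixed point by continuity. *)
Lemma cvg_iter_up phi x : free_map p q phi ->
  (forall y, y \in `]p, q[ -> y < phi y) ->
  x \in `]p, q[ -> iter n phi x @[n --> \oo] --> q.
Proof.
move=> F up xJ; have xnJ n := free_map_iter n F xJ.
have nd : nondecreasing_seq (fun n => iter n phi x).
  by apply/nondecreasing_seqP => n; exact/ltW/up.
have cv : cvgn (fun n => iter n phi x).
  apply: nondecreasing_is_cvgn nd _; exists q => _ [n _ <-].
  by have := xnJ n; rewrite in_itv => /andP[_ /ltW].
set l := limn (fun n => iter n phi x) in cv.
have lq : l <= q.
  apply: limr_le => //; apply: nearW => n.
  by have := xnJ n; rewrite in_itv => /andP[_ /ltW].
have xl : x <= l by exact: (nondecreasing_cvgn_le nd cv 0%N).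
suff -> : q = l by [].
apply/eqP; rewrite eq_sym; move: lq; rewrite le_eqVlt => /predU1P[->//|lltq].
have lJ : l \in `]p, q[.
  by move: xJ; rewrite !in_itv /= => /andP[px _]; rewrite lltq (lt_le_trans px xl).
have [_ _ pc pfree] := F.
have c1 : (phi \o (fun n => iter n phi x)) n @[n --> \oo] --> phi l.
  exact: continuous_cvg (pc _ lJ) cv.
have c2 : (phi \o (fun n => iter n phi x)) n @[n --> \oo] --> l.
  by have := cv; rewrite -cvg_shiftS.
by have := pfree _ lJ; rewrite (cvg_unique _ c1 c2) // eqxx.
Qed.

Lemma cvg_iter_end phi : p < q -> free_map p q phi ->
  exists2 e, e \in `[p, q] &
    forall x, x \in `]p, q[ -> iter n phi x @[n --> \oo] --> e.
Proof.
move=> pq F; have [up|down] := free_map_sign F.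
  exists q => [|x]; last exact: cvg_iter_up.
  by rewrite in_itv /= lexx ltW.
exists p => [|x xJ]; first by rewrite in_itv /= lexx ltW.
have F' := flip_conj_free_map F.
have up' y : y \in `]p, q[ -> y < (flip \o phi \o flip) y.
  by rewrite -flip_itv => /down; rewrite /= /flip; lra.
have := xJ; rewrite -flip_itv => /(cvg_iter_up F' up') c.
have -> : p = flip q by rewrite /flip; lra.
have -> : (fun n => iter n phi x) =
    flip \o (fun n => iter n (flip \o phi \o flip) (flip x)).
  by apply/funext => n /=; rewrite iter_flip_conj flipK.
by apply: continuous_cvg c; exact: flip_continuous.
Qed.

(** If a <= x <= phi^k a, the n-th term is at most phi^(n+k) a - phi^n a; adding
    these up over n telescopes into k increments, each at most q - p. *)
Lemma displacement_bounded_up phi : free_map p q phi ->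
  (forall y, y \in `]p, q[ -> y < phi y) -> displacement_bounded p q phi.
Proof.
move=> F up.
suff H a x : a \in `]p, q[ -> x \in `]p, q[ -> a <= x ->
    exists M, forall N, \sum_(0 <= k < N) `|iter k phi x - iter k phi a| <= M.
  move=> a x aJ xJ; have [ax|/ltW xa] := leP a x; first exact: H.
  have [M HM] := H _ _ xJ aJ xa; exists M => N.
  by under eq_bigr do rewrite distrC.
move=> aJ xJ ax.
have akJ k := free_map_iter k F aJ.
have [k xak] : exists k, x <= iter k phi a.
  have xq : x < q by move: xJ; rewrite in_itv => /andP[].
  have [k _ Hk] := cvgr_gt _ (cvg_iter_up F up aJ) _ xq.
  by exists k; apply/ltW/Hk => /=.
exists (k%:R * (q - p)) => N.
apply: (@le_trans _ _ (\sum_(0 <= n < N) (iter (n + k) phi a - iter n phi a))).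
  apply: ler_sum => n _; rewrite ger0_norm ?subr_ge0; last exact: iter_le_homo.
  by rewrite lerB // iterD; exact: iter_le_homo.
elim: k {xak} => [|k IH].
  by rewrite mul0r big1 // => n _; rewrite addn0 subrr.
have -> : \sum_(0 <= n < N) (iter (n + k.+1) phi a - iter n phi a) =
    \sum_(0 <= n < N) (iter (n.+1 + k) phi a - iter (n + k) phi a) +
    \sum_(0 <= n < N) (iter (n + k) phi a - iter n phi a).
  rewrite -big_split /=; apply: eq_bigr => n _.
  by rewrite addnS /=; lra.
rewrite (telescope_sumr (fun n => iter (n + k) phi a)) // -natr1 mulrDl mul1r addrC.
apply: lerD => //.
have := akJ (N + k)%N; have := akJ (0 + k)%N.
by rewrite !in_itv /= => /andP[? ?] /andP[? ?]; lra.
Qed.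

Lemma free_map_displacement phi : free_map p q phi -> displacement_bounded p q phi.
Proof.
move=> F; have [up|down] := free_map_sign F; first exact: displacement_bounded_up.
move=> a x aJ xJ; have F' := flip_conj_free_map F.
have up' y : y \in `]p, q[ -> y < (flip \o phi \o flip) y.
  by rewrite -flip_itv => /down; rewrite /= /flip; lra.
have aJ' : flip a \in `]p, q[ by rewrite flip_itv.
have xJ' : flip x \in `]p, q[ by rewrite flip_itv.
have [M HM] := displacement_bounded_up F' up' aJ' xJ'; exists M => N.
apply: le_trans (HM N); apply: ler_sum => n _.
rewrite !iter_flip_conj [X in _ <= `|X|](_ : _ = iter n phi a - iter n phi x).
  by rewrite distrC.
by rewrite /flip; lra.
Qed.

(** From ln (a / b) <= a / b - 1. *)
Lemma ln_lipschitz_ge (m s t : R) : 0 < m -> m <= s -> m <= t ->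
  `|ln s - ln t| <= m^-1 * `|s - t|.
Proof.
move=> m0.
have H a b : m <= a -> m <= b -> ln a - ln b <= m^-1 * `|a - b|.
  move=> ma mb; have a0 := lt_le_trans m0 ma; have b0 := lt_le_trans m0 mb.
  have : 1 + ln (a / b) <= a / b.
    by rewrite -[leRHS](@lnK _ (a / b)) ?expR_ge1Dx // posrE divr_gt0.
  rewrite ln_div ?posrE // -lerBrDl => /le_trans; apply.
  rewrite -[X in _ - X](@divff _ b) ?gt_eqF // -mulrBl mulrC.
  apply: (@le_trans _ _ (b^-1 * `|a - b|)).
    by rewrite ler_wpM2l ?invr_ge0 ?ler_norm // ltW.
  by rewrite ler_wpM2r // lef_pV2.
move=> ms mt; rewrite ler_norml lerNl opprB distrC.
by rewrite (H t s) //= distrC; exact: H.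
Qed.

(** The logarithms of the factors are dominated by a multiple of the displacements,
    so their series converges absolutely; being an exponential, the limit of the
    products is positive. *)
Lemma prod_orbit_cvg phi (u : R -> R) (m C : R) (a x : R) : free_map p q phi ->
  0 < m -> 0 <= C -> (forall y, y \in `]p, q[ -> m <= u y) ->
  (forall y z, y \in `]p, q[ -> z \in `]p, q[ -> `|u y - u z| <= C * `|y - z|) ->
  a \in `]p, q[ -> x \in `]p, q[ ->
  let P := fun N => \prod_(0 <= k < N) (u (iter k phi x) / u (iter k phi a)) in
  cvgn P /\ 0 < limn P.
Proof.
move=> F m0 C0 mu uC aJ xJ P.
have akJ k := free_map_iter k F aJ; have xkJ k := free_map_iter k F xJ.
have u0 y : y \in `]p, q[ -> 0 < u y by move=> /mu; exact: lt_le_trans.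
pose t k := ln (u (iter k phi x)) - ln (u (iter k phi a)).
have PE : P = expR \o series t.
  apply/funext => N; rewrite /P /series /= expR_sum; apply: eq_bigr => k _.
  by rewrite /t expRB !lnK ?posrE ?u0.
have [M HM] := free_map_displacement F aJ xJ.
have tc : cvgn (series t).
  apply: normed_cvg; apply: nondecreasing_is_cvgn.
    by apply/nondecreasing_seqP => n; rewrite [leRHS]big_nat_recr //= lerDl.
  exists (m^-1 * C * M) => _ [N _ <-]; rewrite /series /=.
  apply: (@le_trans _ _ (m^-1 * C * \sum_(0 <= k < N) `|iter k phi x - iter k phi a|)).
    rewrite mulr_sumr; apply: ler_sum => k _.
    apply: le_trans (ln_lipschitz_ge m0 (mu _ (xkJ k)) (mu _ (akJ k))) _.
    by rewrite -mulrA ler_wpM2l ?invr_ge0 ?(ltW m0) // uC.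
  by rewrite ler_wpM2l // mulr_ge0 // invr_ge0 ltW.
have Pc : P n @[n --> \oo] --> expR (limn (series t)).
  by rewrite PE; apply: continuous_cvg tc; exact: continuous_expR.
split; first by apply/cvg_ex; eexists; exact: Pc.
by rewrite (cvg_lim _ Pc) // expR_gt0.
Qed.

End Free_map.

(** * Diffeomorphisms of a compact interval *)

Section Interval_diffeo.
Variables (R : realType) (p q : R).
Hypothesis pq : p < q.
Let I : set R := `[p, q]%classic.

(** The chain rule for the inverse of f after f gives a product equal to 1. *)
Lemma diffeo_derive_neq0 f x : diffeo I f -> I x -> derive_on I f x != 0.
Proof.
move=> fD Ix; have PF := proper_within_itv pq Ix.
have : derive_on I (pinv I f \o f) x = 1.
  rewrite (@eq_in_derive_on _ _ _ id) ?derive_on_id //.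
  by move=> y Iy; exact: (diffeoK fD).
rewrite (derive_on_comp PF Ix (@diffeo_fun _ _ _ fD) (diffeo_inj fD)).
- by move=> H; apply/eqP => f0; move: H; rewrite f0 mulr0 => /esym/eqP; rewrite oner_eq0.
- exact: (diffeo_derivable fD).
- exact: (diffeo_derivable (diffeo_pinv fD) (diffeo_fun fD Ix)).
Qed.

Lemma diffeo_strict_monotonic f : diffeo I f ->
  {in `[p, q] &, {homo f : x y / x < y}} \/
  {in `[p, q] &, {homo f : x y / x < y >-> y < x}}.
Proof.
move=> fD; have : {in `[p, q] &, injective f}.
  by move=> x y Ix Iy; apply: (diffeo_inj fD); rewrite inE.
move=> /(itv_continuous_inj_mono (diffeo_continuous fD)) [inc|dec]; [left|right] => // x y xI yI.
exact: dec.
Qed.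

(** Strict monotonicity puts f x strictly between f p and f q, which lie in
    [p, q]. *)
Lemma diffeo_itvoo f x : diffeo I f -> x \in `]p, q[ -> f x \in `]p, q[.
Proof.
move=> fD xJ; have pI : p \in `[p, q] by rewrite in_itv /= lexx ltW.
have qI : q \in `[p, q] by rewrite in_itv /= lexx ltW.
have xI : x \in `[p, q] by apply: subset_itv_oo_cc.
have := diffeo_fun fD pI; have := diffeo_fun fD qI.
move: xJ; rewrite /I /= !in_itv /= => /andP[px xq] /andP[? ?] /andP[? ?].
by have [H|H] := diffeo_strict_monotonic fD; have := H _ _ pI xI px;
  have := H _ _ xI qI xq => ? ?; apply/andP; split; lra.
Qed.

Section Free_diffeo.
Variable f : R -> R.
Hypotheses (fD : diffeo I f) (ffree : forall x, x \in `]p, q[ -> f x != x).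

(** A decreasing diffeomorphism satisfies f q < f p, so that f - id changes sign on
    [p, q] but vanishes at neither endpoint, and f has a fixed point inside. *)
Lemma free_diffeo_increasing : {in `[p, q] &, {homo f : x y / x < y}}.
Proof.
have [//|dec] := diffeo_strict_monotonic fD; exfalso.
have pI : p \in `[p, q] by rewrite in_itv /= lexx ltW.
have qI : q \in `[p, q] by rewrite in_itv /= lexx ltW.
have fpI := diffeo_fun fD pI; have fqI := diffeo_fun fD qI.
have fqp := dec _ _ pI qI pq.
have c0 : {within `[p, q], continuous (fun z => f z - z)}.
  apply/subspace_continuousP => z zI; apply: cvgB; last exact: cvg_within.
  by have /subspace_continuousP := diffeo_continuous fD; apply.
have [|c cI /eqP] := IVT (ltW pq) c0 (v := 0).
  move: fpI fqI; rewrite /I /= !in_itv /= => /andP[? ?] /andP[? ?].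
  by rewrite ge_min le_max !subr_le0 !subr_ge0; apply/andP; split; apply/orP; [right|left].
rewrite subr_eq0; apply/negP.
have [cJ|] := boolP (c \in `]p, q[); first exact: ffree.
move: cI fpI fqI; rewrite /I /= !in_itv /= negb_and -!leNgt.
move=> /andP[pc cq] /andP[? ?] /andP[? ?] /orP[cp|qc].
  by rewrite (@le_anti _ _ c p) ?pc ?cp //; apply/eqP; lra.
by rewrite (@le_anti _ _ c q) ?qc ?cq //; apply/eqP; lra.
Qed.

Lemma free_diffeo_free_map : free_map p q f.
Proof.
split=> [x| x y xJ yJ| x xJ|//]; first exact: diffeo_itvoo.
  rewrite le_eqVlt => /predU1P[->//|xy]; apply/ltW.
  by apply: free_diffeo_increasing => //; exact: subset_itv_oo_cc.
exact: within_continuous_continuous pq (diffeo_continuous fD) xJ.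
Qed.

Lemma free_diffeo_derive_gt0 x : I x -> 0 < derive_on I f x.
Proof.
move=> Ix; have PF := proper_within_itv pq Ix.
rewrite lt_neqAle eq_sym diffeo_derive_neq0 //=.
apply: limr_ge; first exact: (diffeo_derivable fD).
apply/near_within_dnbhs; apply: (@filterE _ (nbhs x)) => y yx Iy.
rewrite /diff_quot; case: (ltgtP x y) => [xy|xy|xy].
- by rewrite divr_ge0 // subr_ge0 ltW // free_diffeo_increasing.
- by rewrite -mulrNN -invrN !opprB divr_ge0 // subr_ge0 ltW // free_diffeo_increasing.
- by rewrite xy eqxx in yx.
Qed.

Lemma free_diffeo_orbit_prod phi a x : free_map p q phi ->
  a \in `]p, q[ -> x \in `]p, q[ ->
  let P N := \prod_(0 <= k < N)
    (derive_on I f (iter k phi x) / derive_on I f (iter k phi a)) in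
  cvgn P /\ 0 < limn P.
Proof.
move=> F aJ xJ P.
have [c cI cmin] := EVT_min (ltW pq) (diffeo_derive_continuous fD).
have [_ f2 _] := fD.
have [||C C0 HC] := lipschitz_derive_on pq (F := derive_on I f).
- by move=> y; exact: (f2 1%N).
- by apply: within_continuous_derivable_on => y; exact: (f2 2%N).
apply: (@prod_orbit_cvg _ p q _ _ (derive_on I f c) C) => //.
- by apply: free_diffeo_derive_gt0; exact: cI.
- by move=> y yJ; apply: cmin; exact: subset_itv_oo_cc.
- by move=> y z yJ zJ; apply: HC; exact: subset_itv_oo_cc.
Qed.

End Free_diffeo.

Lemma pinv_free f : diffeo I f -> (forall x, x \in `]p, q[ -> f x != x) ->
  forall x, x \in `]p, q[ -> pinv I f x != x.
Proof.
move=> fD ff x xJ; apply: contra_neq (ff x xJ) => {1}<-.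
by apply: diffeo_pinvK => //; exact: subset_itv_oo_cc.
Qed.

(** The right product runs over the orbits of x and a under f, and the left
    one over the orbits of their preimages under the inverse of f. *)
Lemma F_factor_biprod_cvg f a x : diffeo I f ->
  (forall x, x \in `]p, q[ -> f x != x) ->
  a \in `]p, q[ -> x \in `]p, q[ ->
  biprod_cvg (F_factor I f a x) /\ 0 < F_prod I f a x.
Proof.
move=> fD ff aJ xJ; have F := free_diffeo_free_map fD ff.
have F' := free_diffeo_free_map (diffeo_pinv fD) (pinv_free fD ff).
have [rc r0] : cvgn (prod_right (F_factor I f a x)) /\
    0 < limn (prod_right (F_factor I f a x)).
  exact (free_diffeo_orbit_prod fD ff F aJ xJ).
have J' y : y \in `]p, q[ -> pinv I f y \in `]p, q[.
  exact: diffeo_itvoo (diffeo_pinv fD).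
have [lc l0] : cvgn (prod_left (F_factor I f a x)) /\
    0 < limn (prod_left (F_factor I f a x)).
  have -> : prod_left (F_factor I f a x) = fun N => \prod_(0 <= k < N)
      (derive_on I f (iter k (pinv I f) (pinv I f x)) /
       derive_on I f (iter k (pinv I f) (pinv I f a))).
    by apply/funext => N; apply: eq_bigr => k _; rewrite -!iterSr.
  exact (free_diffeo_orbit_prod fD ff F' (J' _ aJ) (J' _ xJ)).
split; last by rewrite /F_prod /biprod; exact: mulr_gt0 l0 r0.
exact (And4 rc (lt0r_neq0 r0) lc (lt0r_neq0 l0)).
Qed.

Lemma cvg_comp_within (u : R^nat) (F : R -> R) e : {within I, continuous F} ->
  I e -> (forall n, I (u n)) -> u n @[n --> \oo] --> e -> F (u n) @[n --> \oo] --> F e.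
Proof.
move=> /subspace_continuousP cF Ie uI ue; apply: (cvg_comp u F _ (cF _ Ie)) => P.
move=> /near_within_nbhs/ue HP.
have {}HP : \forall n \near \oo, I (u n) -> P (u n) by exact: HP.
have : \forall n \near \oo, P (u n) by apply: filterS HP => n; apply; exact: uI.
by [].
Qed.

(** * Conjugate diffeomorphisms *)

Section Conjugacy.
Variables f g h : R -> R.
Hypotheses (fD : diffeo I f) (gD : diffeo I g) (hD : diffeo I h).
Hypothesis hfg : forall x, I x -> h (f x) = g (h x).

Lemma conj_pinv x : I x -> h (pinv I f x) = pinv I g (h x).
Proof.
move=> Ix; have If := diffeo_fun (diffeo_pinv fD) Ix.
by rewrite -[in RHS](diffeo_pinvK fD Ix) hfg // (diffeoK gD) //; exact: diffeo_fun.
Qed.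

Lemma iterz_fun phi n x : diffeo I phi -> I x -> I (iterz I phi n x).
Proof.
move=> D Ix; case: n => n; last first.
  by rewrite /iterz; elim: n.+1 => //= k; exact: (diffeo_fun (diffeo_pinv D)).
by rewrite /iterz; elim: n => //= k; exact: (diffeo_fun D).
Qed.

Lemma conj_iterz n x : I x -> iterz I g n (h x) = h (iterz I f n x).
Proof.
move=> Ix; case: n => n; rewrite /iterz.
  elim: n => // n IH; rewrite !iterS IH hfg //.
  exact: (@iterz_fun f n).
elim: n => [|n IH]; first by rewrite /= conj_pinv.
rewrite iterS IH [in RHS]iterS conj_pinv //.
exact: (@iterz_fun f (Negz n)).
Qed.

(** The chain rule applied to both sides of h o f = g o h. *)
Lemma conj_derive_ratio x : I x ->
  derive_on I f x / derive_on I g (h x) = derive_on I h x / derive_on I h (f x).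
Proof.
move=> Ix; have PF := proper_within_itv pq Ix.
have Ifx := diffeo_fun fD Ix; have Ihx := diffeo_fun hD Ix.
have e : derive_on I (h \o f) x = derive_on I (g \o h) x by exact: eq_in_derive_on.
move: e; rewrite (derive_on_comp PF Ix (@diffeo_fun _ _ _ fD) (diffeo_inj fD)).
- rewrite (derive_on_comp PF Ix (@diffeo_fun _ _ _ hD) (diffeo_inj hD)).
  + by move=> e; apply/eqP; rewrite eqr_div ?diffeo_derive_neq0 // mulrC e mulrC.
  + exact: (diffeo_derivable hD).
  + exact: (diffeo_derivable gD).
- exact: (diffeo_derivable fD).
- exact: (diffeo_derivable hD).
Qed.

Lemma prod_right_H x N : I x -> prod_right (H_factor I f g x (h x)) N =
  derive_on I h x / derive_on I h (iter N f x).
Proof.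
move=> Ix; have Ik k : I (iter k f x) by exact: (@iterz_fun f k).
rewrite /prod_right; elim: N => [|N IH].
  by rewrite big_nil divff // diffeo_derive_neq0.
rewrite big_nat_recr //= IH /H_factor conj_iterz //= conj_derive_ratio //.
by rewrite mulrA mulfVK // diffeo_derive_neq0.
Qed.

Lemma prod_left_H x N : I x -> prod_left (H_factor I f g x (h x)) N =
  derive_on I h (iter N (pinv I f) x) / derive_on I h x.
Proof.
move=> Ix; rewrite /prod_left; elim: N => [|N IH].
  by rewrite big_nil divff // diffeo_derive_neq0.
have IN : I (iter N.+1 (pinv I f) x) by exact: (@iterz_fun f (Negz N)).
have IN' : I (iter N (pinv I f) x).
  by elim: N {IH IN} => //= k; exact: (diffeo_fun (diffeo_pinv fD)).
rewrite big_nat_recr //= IH /H_factor conj_iterz // conj_derive_ratio //.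
(* f undoes one step of the backward orbit. *)
rewrite mulrC [X in derive_on I h (f X)]/= (diffeo_pinvK fD IN') /=.
by rewrite mulrA mulfVK // diffeo_derive_neq0.
Qed.

(** With r and l the limits of the forward and backward orbits, the constant is
    (h'(l) / h'(x)) (h'(x) / h'(r)). *)
Lemma H_prod_constant : (forall x, x \in `]p, q[ -> f x != x) ->
  exists2 c, c != 0 & forall x, x \in `]p, q[ ->
    biprod_cvg (H_factor I f g x (h x)) /\ H_prod I f g x (h x) = c.
Proof.
move=> ff; have F := free_diffeo_free_map fD ff.
have F' := free_diffeo_free_map (diffeo_pinv fD) (pinv_free fD ff).
have [r rI rc] := cvg_iter_end pq F; have [l lI lc] := cvg_iter_end pq F'.
have dn0 x : I x -> derive_on I h x != 0 by exact: diffeo_derive_neq0.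
exists (derive_on I h l / derive_on I h r); first by rewrite mulf_neq0 ?invr_eq0 ?dn0.
move=> x xJ; have xI : I x by exact: subset_itv_oo_cc.
have JI y : y \in `]p, q[ -> I y by exact: subset_itv_oo_cc.
have cR : prod_right (H_factor I f g x (h x)) n @[n --> \oo] -->
    derive_on I h x / derive_on I h r.
  have -> : prod_right (H_factor I f g x (h x)) =
      fun N => derive_on I h x / derive_on I h (iter N f x).
    by apply/funext => N; exact: prod_right_H.
  apply: cvgM; first exact: cvg_cst.
  apply: cvgV; first exact: dn0.
  apply: cvg_comp_within (rc _ xJ) => //; first exact: diffeo_derive_continuous.
  by move=> n; apply: JI; exact: free_map_iter.
have cL : prod_left (H_factor I f g x (h x)) n @[n --> \oo] -->
    derive_on I h l / derive_on I h x.
  have -> : prod_left (H_factor I f g x (h x)) =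
      fun N => derive_on I h (iter N (pinv I f) x) / derive_on I h x.
    by apply/funext => N; exact: prod_left_H.
  apply: cvgM; last exact: cvg_cst.
  apply: cvg_comp_within (lc _ xJ) => //; first exact: diffeo_derive_continuous.
  by move=> n; apply: JI; exact: free_map_iter.
have lR := cvg_lim (@Rhausdorff R) cR; have lL := cvg_lim (@Rhausdorff R) cL.
split; last by rewrite /H_prod /biprod lR lL mulrA mulfVK ?dn0.
split; [exact: cvgP cR| |exact: cvgP cL|].
- by rewrite lR mulf_neq0 ?invr_eq0 ?dn0.
- by rewrite lL mulf_neq0 ?invr_eq0 ?dn0.
Qed.

End Conjugacy.
End Interval_diffeo.

Lemma biprod_mul (R : realType) (u v : int -> R) : biprod_cvg u -> biprod_cvg v ->
  biprod (fun n => u n * v n) = biprod u * biprod v /\ biprod_cvg (fun n => u n * v n).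
Proof.
move=> [ur ur0 ul ul0] [vr vr0 vl vl0].
have rE : prod_right (fun n => u n * v n) = fun N => prod_right u N * prod_right v N.
  by apply/funext => N; exact: big_split.
have lE : prod_left (fun n => u n * v n) = fun N => prod_left u N * prod_left v N.
  by apply/funext => N; exact: big_split.
have cR : prod_right u N * prod_right v N @[N --> \oo] -->
    limn (prod_right u) * limn (prod_right v) by exact: cvgM.
have cL : prod_left u N * prod_left v N @[N --> \oo] -->
    limn (prod_left u) * limn (prod_left v) by exact: cvgM.
have lR := cvg_lim (@Rhausdorff R) cR; have lL := cvg_lim (@Rhausdorff R) cL.
rewrite /biprod /biprod_cvg rE lE lR lL; split; first by rewrite mulrACA.
by split; [exact: cR|exact: mulf_neq0|exact: cL|exact: mulf_neq0].
Qed.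

(** One factor of the comparison: both sides are fx / s. *)
Lemma cross_ratioE (K : fieldType) (fx gx fa ga s : K) :
  gx != 0 -> fa != 0 -> ga != 0 ->
  fx / gx * (gx / s) = fa / ga * (fx / fa * (ga / s)).
Proof.
move=> gx0 fa0 ga0; rewrite mulrA mulfVK // mulrCA !mulrA mulfVK //.
by rewrite mulfVK.
Qed.

Theorem proposition2p9 (R : realType) (p q : R) (f g h : R -> R) :
  let I : set R := `[p, q]%classic in
  let J : set R := `]p, q[%classic in
  p < q ->
  diffeo I f -> diffeo I g -> diffeo I h ->
  (forall x, J x -> f x <> x) ->
  (forall x, I x -> f x = pinv I h (g (h x))) ->
  (exists c : R, forall x, J x ->
     biprod_cvg (H_factor I f g x (h x)) /\ H_prod I f g x (h x) = c) /\
  (forall a alpha : R, J a -> J alpha ->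
     exists kappa : R, 0 < kappa /\
       forall x, J x ->
         [/\ biprod_cvg (F_factor I f a x),
             biprod_cvg (F_factor I g alpha (h x)) &
             F_prod I f a x = kappa * F_prod I g alpha (h x)]).
Proof.
move=> I J pq fD gD hD ff fE.
have JI x : J x -> I x by exact: subset_itv_oo_cc.
have ffree x : x \in `]p, q[ -> f x != x by move=> /ff/eqP.
have hfg x : I x -> h (f x) = g (h x).
  move=> Ix; rewrite fE // (diffeo_pinvK hD) //.
  exact: (diffeo_fun gD (diffeo_fun hD Ix)).
have gfree y : y \in `]p, q[ -> g y != y.
  move=> yJ; have pyJ := diffeo_itvoo pq (diffeo_pinv hD) yJ.
  apply: contra_neq (ffree _ pyJ) => gy.
  by rewrite fE ?(diffeo_pinvK hD (JI _ yJ)) ?gy //; exact: JI.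
have [c c0 Hc] := H_prod_constant pq fD gD hD hfg ffree.
split; first by exists c.
move=> a alpha aJ alJ.
have hJ x : J x -> J (h x) by exact: (diffeo_itvoo pq hD).
have [Ga Ga0] := F_factor_biprod_cvg pq gD gfree alJ (hJ _ aJ).
exists (F_prod I g alpha (h a))^-1; split; first by rewrite invr_gt0.
move=> x xJ.
have [Gx _] := F_factor_biprod_cvg pq gD gfree alJ (hJ _ xJ).
have [Fx _] := F_factor_biprod_cvg pq fD ffree aJ xJ.
refine (And3 Fx Gx _).
have [Hx Hxc] := Hc _ xJ; have [Ha Hac] := Hc _ aJ.
have g0 y n : J y -> derive_on I g (iterz I g n y) != 0.
  by move=> yJ; apply: diffeo_derive_neq0 => //; apply: iterz_fun => //; exact: JI.
have f0 y n : J y -> derive_on I f (iterz I f n y) != 0.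
  by move=> yJ; apply: diffeo_derive_neq0 => //; apply: iterz_fun => //; exact: JI.
have E : (fun n => H_factor I f g x (h x) n * F_factor I g alpha (h x) n) =
    (fun n => H_factor I f g a (h a) n *
      (F_factor I f a x n * F_factor I g alpha (h a) n)).
  apply/funext => n; rewrite /H_factor /F_factor.
  exact: cross_ratioE (g0 _ n (hJ _ xJ)) (f0 _ n aJ) (g0 _ n (hJ _ aJ)).
have [EL _] := biprod_mul Hx Gx; have [E1 Fc] := biprod_mul Fx Ga.
have [E2 _] := biprod_mul Ha Fc.
have e : c * F_prod I g alpha (h x) =
    c * (F_prod I f a x * F_prod I g alpha (h a)).
  by rewrite -{1}Hxc -Hac -[LHS]EL E E2 E1.
by rewrite (mulfI c0 e) mulrC (mulfK (lt0r_neq0 Ga0)).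
Qed.
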